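(* Let $1\le r\le e\le q$ be integers with $r+e+q=n$, let $P_1=(x_1,\dots,x_r)$, $P_2=(x_{r+1},\dots,x_{r+e})$, $P_3=(x_{r+e+1},\dots,x_{r+e+q})$ be prime ideals of $S=K[x_1,\dots,x_n]$, and let $I=P_1\cap P_2\cap P_3$. Suppose that $r\le\lceil\frac{e}{2}\rceil$. Then $$\operatorname{sdepth}(S/I)=r+\min\left\{e,\left\lceil\frac{q}{2}\right\rceil\right\}.$$
   Context: $K$ is a field and $S=K[x_1,\dots,x_n]$ is the polynomial ring, with its standard $\mathbb{Z}^n$-grading. Let $M$ be a finitely generated $\mathbb{Z}^n$-graded $S$-module. For a homogeneous $u\in M$ and a subset $Z\subset\{x_1,\dots,x_n\}$, $uK[Z]$ denotes the $K$-subspace of $M$ generated by all $uv$, $v$ a monomial in $K[Z]$; if $uK[Z]$ is a free $K[Z]$-module it is called a Stanley space of dimension $|Z|$. A Stanley decomposition of $M$ is a presentation of $M$ as a finite direct sum of $\mathbb{Z}^n$-graded $K$-vector spaces $\mathcal{D}: M=\bigoplus_{i=1}^{s}u_iK[Z_i]$ with each $u_iK[Z_i]$ a Stanley space; $\operatorname{sdepth}\mathcal{D}=\min_i|Z_i|$, and $\operatorname{sdepth} M$ is the maximum of $\operatorname{sdepth}\mathcal{D}$ over all Stanley decompositions $\mathcal{D}$ of $M$. *)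

(* Defs.v *)
From HB Require Import structures.
From mathcomp Require Import all_boot all_order all_algebra.
From mathcomp Require Import ring_quotient mpoly.
From mathcomp Require boolp.

Set Implicit Arguments.
Unset Strict Implicit.
Unset Printing Implicit Defensive.

Import GRing.Theory.
Local Open Scope ring_scope.
Local Open Scope quotient_scope.

Notation degree n := {ffun 'I_n -> int}.

Definition zdeg n (m : 'X_{1..n}) : degree n := [ffun i => (m i)%:Z].

(* Finitely generated Z^n-graded modules over S = K[x_1, ..., x_n], the scalar *)
(* c of K acting as the constant polynomial c%:MP.  [gm_sum] and [gm_indep]    *)
(* say that M is the direct sum of its components.                             *)
Record gradedModule (K : fieldType) (n : nat) := GradedModule {
  gm_module :> lmodType {mpoly K[n]};
  gm_comp : degree n -> gm_module -> Prop;
  gm_comp0 : forall a, gm_comp a 0;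
  gm_compD : forall a u v, gm_comp a u -> gm_comp a v -> gm_comp a (u + v);
  gm_compZ : forall a (c : K) u, gm_comp a u -> gm_comp a (c%:MP *: u);
  gm_compX : forall a (m : 'X_{1..n}) u,
    gm_comp a u -> gm_comp (zdeg m + a) ('X_[m] *: u);
  gm_sum : forall u, exists (s : seq (degree n)) (f : degree n -> gm_module),
    (forall a, gm_comp a (f a)) /\ u = \sum_(a <- s) f a;
  gm_indep : forall (s : seq (degree n)) (f : degree n -> gm_module),
    uniq s -> (forall a, gm_comp a (f a)) -> \sum_(a <- s) f a = 0 ->
    forall a, a \in s -> f a = 0;
  gm_fingen : exists (k : nat) (g : 'I_k -> gm_module),
    forall u, exists c : 'I_k -> {mpoly K[n]}, u = \sum_j c j *: g j
}.

Section StanleyDepth.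
Variables (K : fieldType) (n : nat) (M : gradedModule K n).
Implicit Types (Z : {set 'I_n}) (u x : M).

Definition homogeneous u : Prop := exists a, gm_comp a u.

Definition monomial_on Z (m : 'X_{1..n}) : bool :=
  [forall i, (m i != 0%N) ==> (i \in Z)].

Definition poly_on Z (p : {mpoly K[n]}) : bool := all (monomial_on Z) (msupp p).

(* x \in u K[Z], the K-span of the u v with v a monomial in K[Z] *)
Definition in_uKZ u Z x : Prop :=
  exists (s : seq 'X_{1..n}) (c : 'X_{1..n} -> K),
    all (monomial_on Z) s /\ x = \sum_(m <- s) (c m)%:MP *: ('X_[m] *: u).

(* N is free over K[Z], with a finite basis b.  This is applied only to        *)
(* N = u K[Z], which is generated by one element, so that no infinite basis is *)
(* left out.                                                                   *)
Definition KZ_free Z (N : M -> Prop) : Prop :=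
  exists (k : nat) (b : 'I_k -> M),
    (forall j, N (b j)) /\
    (forall x, N x -> exists! c : {ffun 'I_k -> {mpoly K[n]}},
       (forall j, poly_on Z (c j)) /\ x = \sum_j c j *: b j).

(* The zero space, free on the empty basis, is not excluded: dropping zero     *)
(* summands from a decomposition can only increase its Stanley depth.          *)
Definition stanley_space u Z : Prop := KZ_free Z (in_uKZ u Z).

Record stanleyDecomposition := StanleyDecomposition {
  sd_size : nat;
  sd_gen : 'I_sd_size -> M;
  sd_vars : 'I_sd_size -> {set 'I_n};
  sd_homogeneous : forall i, homogeneous (sd_gen i);
  sd_stanley : forall i, stanley_space (sd_gen i) (sd_vars i);
  sd_direct : forall x, exists! y : {ffun 'I_sd_size -> M},
    (forall i, in_uKZ (sd_gen i) (sd_vars i) (y i)) /\ x = \sum_i y i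
}.

(* The neutral value n matters only for the empty decomposition of M = 0. *)
Definition sdepth_dec (D : stanleyDecomposition) : nat :=
  \big[minn/n]_(i < sd_size D) #|@sd_vars D i|.

(* Since sdepth_dec D <= n always, this is the maximum over all D; it would be *)
(* 0 if there were no decomposition at all.                                    *)
Definition sdepth : nat :=
  \max_(d < n.+1 | boolp.asbool (exists D, sdepth_dec D = d)) d.

End StanleyDepth.

Record gradedIdeal (K : fieldType) (n : nat) := GradedIdeal {
  gi_mem :> {pred {mpoly K[n]}};
  gi_0 : 0 \in gi_mem;
  gi_D : forall p q, p \in gi_mem -> q \in gi_mem -> p + q \in gi_mem;
  gi_M : forall p q, q \in gi_mem -> p * q \in gi_mem;
  gi_graded : forall p (m : 'X_{1..n}),
    p \in gi_mem -> p@_m *: 'X_[m] \in gi_mem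
}.

Section Ideals.
Variables (K : fieldType) (n : nat).
Local Notation S := {mpoly K[n]}.

Section VarIdeal.
Variable J : {set 'I_n}.

Definition var_ideal_mem : {pred S} :=
  fun p => boolp.asbool (exists c : 'I_n -> S, p = \sum_(i in J) c i * 'X_i).

Lemma var_ideal_memP p :
  reflect (exists c : 'I_n -> S, p = \sum_(i in J) c i * 'X_i)
          (p \in var_ideal_mem).
Proof. exact: boolp.asboolP. Qed.

Lemma var_ideal0 : 0 \in var_ideal_mem.
Proof.
by apply/var_ideal_memP; exists (fun=> 0); rewrite big1 // => i _; rewrite mul0r.
Qed.

Lemma var_idealD p q :
  p \in var_ideal_mem -> q \in var_ideal_mem -> p + q \in var_ideal_mem.
Proof.
move=> /var_ideal_memP[c ->] /var_ideal_memP[d ->]; apply/var_ideal_memP.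
exists (fun i => c i + d i); rewrite -big_split /=.
by apply: eq_bigr => i _; rewrite mulrDl.
Qed.

Lemma var_idealM p q : q \in var_ideal_mem -> p * q \in var_ideal_mem.
Proof.
move=> /var_ideal_memP[c ->]; apply/var_ideal_memP.
by exists (fun i => p * c i); rewrite mulr_sumr; apply: eq_bigr => i _; rewrite mulrA.
Qed.

Lemma var_ideal_graded p (m : 'X_{1..n}) :
  p \in var_ideal_mem -> p@_m *: 'X_[m] \in var_ideal_mem.
Proof.
move=> /var_ideal_memP[c ->]; apply/var_ideal_memP.
exists (fun i => (c i * 'X_i)@_m *: 'X_[(m - U_(i))%MM]).
rewrite raddf_sum scaler_suml; apply: eq_bigr => i _.
rewrite -scalerAl -mpolyXD.
have [le_m|nle_m] := boolP (U_(i) <= m)%MM; first by rewrite submK.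
suff c0 : (c i * 'X_i)@_m = 0 by rewrite /= c0 !scale0r.
rewrite [c i]mpolyE mulr_suml raddf_sum big1 //= => k _.
rewrite -scalerAl -mpolyXD mcoeffZ mcoeffX.
case: eqP => [eq_m|_]; last by rewrite mulr0.
by case/negP: nle_m; rewrite -eq_m lem_addl.
Qed.

(* the ideal of S generated by the variables x_i, i \in J *)
Definition var_ideal : gradedIdeal K n :=
  GradedIdeal var_ideal0 var_idealD var_idealM var_ideal_graded.

End VarIdeal.

Section Intersection.
Variables I1 I2 : gradedIdeal K n.

Definition cap_ideal_mem : {pred S} := [predI I1 & I2].

Lemma cap_ideal0 : 0 \in cap_ideal_mem.
Proof. by rewrite inE !gi_0. Qed.

Lemma cap_idealD p q :
  p \in cap_ideal_mem -> q \in cap_ideal_mem -> p + q \in cap_ideal_mem.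
Proof.
by rewrite !inE => /andP[p1 p2] /andP[q1 q2]; rewrite !gi_D.
Qed.

Lemma cap_idealM p q : q \in cap_ideal_mem -> p * q \in cap_ideal_mem.
Proof. by rewrite !inE => /andP[q1 q2]; rewrite !gi_M. Qed.

Lemma cap_ideal_graded p (m : 'X_{1..n}) :
  p \in cap_ideal_mem -> p@_m *: 'X_[m] \in cap_ideal_mem.
Proof. by rewrite !inE => /andP[q1 q2]; rewrite !gi_graded. Qed.

Definition cap_ideal : gradedIdeal K n :=
  GradedIdeal cap_ideal0 cap_idealD cap_idealM cap_ideal_graded.

End Intersection.

Lemma gi_zmod_closed (I : gradedIdeal K n) : zmod_closed (gi_mem I).
Proof.
split=> [|p q pI qI]; first exact: gi_0.
by apply: gi_D => //; rewrite -mulN1r; apply: gi_M.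
Qed.

HB.instance Definition _ (I : gradedIdeal K n) :=
  GRing.isZmodClosed.Build S (gi_mem I) (gi_zmod_closed I).

Section Quotient.
Variable I : gradedIdeal K n.

Definition quot_ideal : Type := Quotient.quot (gi_mem I).

HB.instance Definition _ := GRing.Zmodule.on quot_ideal.

Definition qpi (p : S) : quot_ideal := \pi_(Quotient.quot (gi_mem I)) p.

Lemma qpiP p q : reflect (qpi p = qpi q) (p - q \in I).
Proof. by rewrite Quotient.idealrBE; apply: eqP. Qed.

Lemma qpi0P p : reflect (qpi p = 0) (p \in I).
Proof.
have <- : qpi 0 = 0 by rewrite /qpi raddf0.
by rewrite -{2}[p]subr0; apply: qpiP.
Qed.

Lemma qpiD p q : qpi (p + q) = qpi p + qpi q.
Proof. by rewrite /qpi raddfD. Qed.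

Lemma qpi_sum T (s : seq T) (F : T -> S) :
  qpi (\sum_(t <- s) F t) = \sum_(t <- s) qpi (F t).
Proof. by rewrite /qpi raddf_sum. Qed.

Lemma qpi_surj (u : quot_ideal) : exists p, u = qpi p.
Proof. by exists (repr u); rewrite /qpi reprK. Qed.

Definition quot_scale (p : S) (u : quot_ideal) : quot_ideal := qpi (p * repr u).

Lemma quot_scale_pi p q : quot_scale p (qpi q) = qpi (p * q).
Proof. by apply/qpiP; rewrite -mulrBr gi_M //; apply/qpiP; rewrite /qpi reprK. Qed.

Lemma quot_scaleA p q u : quot_scale p (quot_scale q u) = quot_scale (p * q) u.
Proof. by have [w ->] := qpi_surj u; rewrite !quot_scale_pi mulrA. Qed.

Lemma quot_scale1 : left_id 1 quot_scale.
Proof. by move=> u; have [w ->] := qpi_surj u; rewrite quot_scale_pi mul1r. Qed.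

Lemma quot_scaleDr : right_distributive quot_scale +%R.
Proof.
move=> p u v; have [w ->] := qpi_surj u; have [z ->] := qpi_surj v.
by rewrite -qpiD !quot_scale_pi mulrDr qpiD.
Qed.

Lemma quot_scaleDl u : {morph quot_scale^~ u : p q / p + q}.
Proof.
by move=> p q; have [w ->] := qpi_surj u; rewrite !quot_scale_pi mulrDl qpiD.
Qed.

HB.instance Definition _ := GRing.Zmodule_isLmodule.Build S quot_ideal
  quot_scaleA quot_scale1 quot_scaleDr quot_scaleDl.

Lemma qpiZ p q : qpi (p * q) = p *: qpi q.
Proof. by rewrite -quot_scale_pi. Qed.

Definition homog_poly (a : degree n) (p : S) : Prop :=
  {in msupp p, forall m, zdeg m = a}.

(* the image in S/I of the component of S of degree a *)
Definition quot_comp (a : degree n) (u : quot_ideal) : Prop :=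
  exists p : S, homog_poly a p /\ u = qpi p.

Lemma quot_comp0 a : quot_comp a 0.
Proof.
exists 0; split; first by move=> m; rewrite msupp0.
by apply/esym/qpi0P/gi_0.
Qed.

Lemma quot_compD a u v : quot_comp a u -> quot_comp a v -> quot_comp a (u + v).
Proof.
move=> [p [hp ->]] [q [hq ->]]; exists (p + q); split; last by rewrite qpiD.
by move=> m /msuppD_le; rewrite mem_cat => /orP[/hp|/hq].
Qed.

Lemma quot_compZ a (c : K) u : quot_comp a u -> quot_comp a (c%:MP *: u).
Proof.
move=> [p [hp ->]]; exists (c%:MP * p); split; last by rewrite qpiZ.
by move=> m; rewrite mul_mpolyC => /msuppZ_le /hp.
Qed.

Lemma quot_compX a (m : 'X_{1..n}) u :
  quot_comp a u -> quot_comp (zdeg m + a) ('X_[m] *: u).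
Proof.
move=> [p [hp ->]]; exists ('X_[m] * p); split; last by rewrite qpiZ.
move=> k; rewrite mulrC (perm_mem (msuppMX _ _)) => /mapP[l lp ->].
by rewrite -(hp _ lp); apply/ffunP => i; rewrite !ffunE mnmDE PoszD.
Qed.

Let mdeg_of (a : degree n) : 'X_{1..n} := [multinom `|a i|%N | i < n].

Lemma zdegK m : mdeg_of (zdeg m) = m.
Proof. by apply/mnmP => i; rewrite mnmE ffunE. Qed.

Lemma quot_sum u : exists (s : seq (degree n)) (f : degree n -> quot_ideal),
  (forall a, quot_comp a (f a)) /\ u = \sum_(a <- s) f a.
Proof.
have [p ->] := qpi_surj u; exists [seq zdeg m | m <- msupp p].
exists (fun a => if zdeg (mdeg_of a) == a
                 then qpi (p@_(mdeg_of a) *: 'X_[mdeg_of a]) else 0); split.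
  move=> a; case: eqP => [eq_a|_]; last exact: quot_comp0.
  exists (p@_(mdeg_of a) *: 'X_[mdeg_of a]); split=> // m /msuppZ_le.
  by rewrite msuppX inE => /eqP ->.
rewrite big_map {1}[p]mpolyE qpi_sum; apply: eq_bigr => m _.
by rewrite zdegK eqxx.
Qed.

Lemma quot_indep (s : seq (degree n)) (f : degree n -> quot_ideal) :
  uniq s -> (forall a, quot_comp a (f a)) -> \sum_(a <- s) f a = 0 ->
  forall a, a \in s -> f a = 0.
Proof.
move=> us /boolp.choice[q hq].
have -> : \sum_(a <- s) f a = qpi (\sum_(a <- s) q a).
  by rewrite qpi_sum; apply: eq_bigr => a _; case: (hq a).
move=> /qpi0P qI a as_; have [ha ->] := hq a; apply/qpi0P.
rewrite [q a]mpolyE big_seq; apply: (big_ind (fun p => p \in I)).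
- exact: gi_0.
- exact: gi_D.
move=> m mq; have /gi_graded - /(_ m) := qI.
rewrite raddf_sum (bigD1_seq a) //= big1 ?addr0 // => b nba.
apply: memN_msupp_eq0; apply/negP => mb.
by move: nba; rewrite -((hq b).1 _ mb) (ha _ mq) eqxx.
Qed.

Lemma quot_fingen : exists (k : nat) (g : 'I_k -> quot_ideal),
  forall u, exists c : 'I_k -> S, u = \sum_j c j *: g j.
Proof.
exists 1%N, (fun=> qpi 1) => u; have [p ->] := qpi_surj u.
by exists (fun=> p); rewrite big_ord1 -qpiZ mulr1.
Qed.

Definition quot_module : gradedModule K n :=
  @GradedModule K n quot_ideal quot_comp quot_comp0 quot_compD quot_compZ
    quot_compX quot_sum quot_indep quot_fingen.

End Quotient.
End Ideals.

(* the ideal (x_{a+1}, ..., x_b); variables are indexed from 0 *)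
Definition block_ideal (K : fieldType) (n a b : nat) : gradedIdeal K n :=
  var_ideal K [set i : 'I_n | (a <= i < b)%N].

(* Main.v *)
Require Import Defs.
From mathcomp Require Import all_boot all_algebra.
From mathcomp Require Import ring_quotient mpoly.
From mathcomp Require Import zify.
From mathcomp Require boolp.

(** Write A, B, C for the three blocks of variables, of sizes r, e, q.  A
    monomial lies outside I exactly when its support misses at least one of A,
    B, C, so everything depends on the family of such sets.

    The squarefree monomials of a Stanley space x^F K[Z] are the sets of the
    interval [F, F + Z] (and there are none if the generator is not
    squarefree).  Conversely an interval [F, G] gives the Stanley space
    x^F K[G], whose monomials are those with support in [F, G].  Therefore
    sdepth (S/I) is the largest d such that the family of supports can be
    partitioned into intervals all of whose tops have at least d elements:
    [decomposition_partition] and [partition_leq_sdepth].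

    Lower bound.  The sets that miss a block are of exactly one of three kinds:
    those contained in A + B; a subset of A together with a nonempty subset of
    C; a nonempty subset of B together with a nonempty subset of C.  By a
    theorem of Biro, Howard, Keller, Trotter and Young, the nonempty subsets of
    an m-element set can be partitioned into intervals with tops of size at
    least m/2 ([nonempty_subsets_partition]).  Taking products of partitions
    gives tops of sizes r + e, r + ceil(q/2) and ceil(e/2) + ceil(q/2), and
    the last is at least r + ceil(q/2) because r <= ceil(e/2).

    Upper bound.  The top of the interval of A + B misses C, so it has at most
    r + e elements.  The top of the interval of A misses B or C, say C (the
    other case gives a bound with e for q, and e <= q).  For c
    in C let G_c be the part outside A of the top of the interval of c + A.
    Two distinct c, c' cannot lie in each other's G: otherwise the same interval
    would contain c + A and c' + A, hence A, and its top would meet C.  Counting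
    pairs, the average size of G_c is at most (q + 1)/2
    ([avoiding_top_le]). *)

Set Implicit Arguments.
Unset Strict Implicit.
Unset Printing Implicit Defensive.

Import GRing.Theory.

(** * Interval partitions of families of sets *)

Section Intervals.
Variable V : finType.
Implicit Types (t p : bool) (s : seq V) (X Y J A B C : {set V}).
Implicit Types (W : {set V} * {set V}).
Implicit Types (L : seq ({set V} * {set V})) (D : pred {set V}).

(** A pair W stands for the interval of the sets between W.1 and W.2. *)
Definition covers X W := (W.1 \subset X) && (X \subset W.2).

Definition multiplicity L X := count (covers X) L.

Definition intervals_in J L :=
  all (fun W => (W.1 \subset W.2) && (W.2 \subset J)) L.

(** The family partitioned consists of the subsets of J that satisfy D; keeping
    the ground set J explicit makes products of partitions easy to state. *)
Definition interval_partition J D L :=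
  intervals_in J L /\ forall X, multiplicity L X = (X \subset J) && D X.

Definition tops_ge d L := all (fun W => d <= #|W.2|) L.

Lemma multiplicity_out J L X :
  intervals_in J L -> ~~ (X \subset J) -> multiplicity L X = 0.
Proof.
move=> /allP LJ nXJ; apply/eqP; rewrite -leqn0 leqNgt -has_count.
apply/hasPn=> W /LJ /andP[_ IJ]; apply: contra nXJ => /andP[_ XI].
exact: subset_trans IJ.
Qed.

Lemma interval_partition1 J :
  interval_partition J xpredT [:: (set0, J)].
Proof.
split=> [|X]; first by rewrite /intervals_in /= sub0set subxx.
by rewrite /multiplicity /= /covers /= sub0set addn0 andbT.
Qed.

Definition interval_prod L1 L2 : seq ({set V} * {set V}) :=
  [seq (W1.1 :|: W2.1, W1.2 :|: W2.2) | W1 <- L1, W2 <- L2].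

Lemma covers_prod J1 J2 X W1 W2 : [disjoint J1 & J2] ->
  X \subset J1 :|: J2 ->
  (W1.1 \subset W1.2) && (W1.2 \subset J1) ->
  (W2.1 \subset W2.2) && (W2.2 \subset J2) ->
  covers X (W1.1 :|: W2.1, W1.2 :|: W2.2)
    = covers (X :&: J1) W1 && covers (X :&: J2) W2.
Proof.
move=> dis sX /andP[ab1 bJ1] /andP[ab2 bJ2].
rewrite /covers /= subUset !subsetI (subset_trans ab1 bJ1).
rewrite (subset_trans ab2 bJ2) !andbT andbACA; congr (_ && _).
apply/idP/andP=> [sXb|[s1 s2]]; last first.
  by rewrite -(setIidPl sX) setIUr setUSS.
split.
  apply: subset_trans (setSI J1 sXb) _; rewrite setIUl subUset subsetIl /=.
  have /eqP -> : W2.2 :&: J1 == set0; last exact: sub0set.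
  by rewrite setI_eq0 disjoint_sym (disjointWr bJ2).
apply: subset_trans (setSI J2 sXb) _; rewrite setIUl subUset subsetIl andbT.
have /eqP -> : W1.2 :&: J2 == set0; last exact: sub0set.
by rewrite setI_eq0 (disjointWl bJ1).
Qed.

Lemma interval_partition_prod J1 J2 D1 D2 L1 L2 : [disjoint J1 & J2] ->
    interval_partition J1 D1 L1 -> interval_partition J2 D2 L2 ->
  interval_partition (J1 :|: J2) (fun X => D1 (X :&: J1) && D2 (X :&: J2))
    (interval_prod L1 L2).
Proof.
move=> dis [in1 m1] [in2 m2].
have inP : intervals_in (J1 :|: J2) (interval_prod L1 L2).
  apply/allP=> W /allpairsP[[W1 W2] /= [/(allP in1)/andP[a1 b1]]].
  by move=> /(allP in2)/andP[a2 b2] ->; rewrite /= !setUSS.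
split=> // X; have [sX|nsX] := boolP (X \subset J1 :|: J2); last first.
  exact: multiplicity_out nsX.
transitivity (multiplicity L1 (X :&: J1) * multiplicity L2 (X :&: J2)); last first.
  by rewrite m1 m2 !subsetIr /= mulnb.
clear m1 inP; rewrite /multiplicity /interval_prod.
elim: L1 in1 => //= W1 L1 IH.
move=> /andP[ok1 /IH{}IH]; rewrite count_cat IH mulnDl; congr (_ + _).
rewrite count_map; case: (boolP (covers (X :&: J1) W1)) => c1.
  rewrite mul1n; apply: eq_in_count => W2 /(allP in2) ok2 /=.
  by rewrite (covers_prod dis) // c1.
rewrite mul0n; apply/eqP; rewrite -leqn0 leqNgt -has_count.
apply/hasPn=> W2 /(allP in2) ok2 /=.
by rewrite (covers_prod dis) // negb_and c1.
Qed.

Lemma tops_ge_prod J1 J2 L1 L2 d1 d2 : [disjoint J1 & J2] ->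
    intervals_in J1 L1 -> intervals_in J2 L2 ->
    tops_ge d1 L1 -> tops_ge d2 L2 ->
  tops_ge (d1 + d2) (interval_prod L1 L2).
Proof.
move=> dis in1 in2 t1 t2.
apply/allP=> W /allpairsP[[W1 W2] /= [I1L I2L ->]] /=.
have /andP[_ s1] := allP in1 _ I1L; have /andP[_ s2] := allP in2 _ I2L.
rewrite cardsU; have -> : W1.2 :&: W2.2 = set0.
  by apply/eqP; rewrite setI_eq0 (disjointWl s1) // (disjointWr s2).
by rewrite cards0 subn0 leq_add // ?(allP t1) ?(allP t2).
Qed.

(** * Nonempty subsets of a finite set *)

(** Read a set X along s.  The bottom of its interval collects the elements of X
    at odd distance from the preceding element of X, and the top adds to the
    bottom all elements at even distance from the preceding element of the
    bottom, since adding or dropping those elements does not change any of the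
    parities that are tested.  The flag t says that the head of s counts as
    being at even distance from what precedes s, and p is the parity required of
    the size of the bottom. *)
Fixpoint alternating (t p : bool) (s : seq V) : seq ({set V} * {set V}) :=
  match s with
  | [::] => if p then [::] else [:: (set0, set0)]
  | x :: s =>
    if t then [seq (W.1, x |: W.2) | W <- alternating false p s]
    else [seq (x |: W.1, x |: W.2) | W <- alternating false (~~ p) s]
         ++ alternating true p s
  end.

Lemma alternating_in t p s : intervals_in [set:: s] (alternating t p s).
Proof.
elim: s t p => [|x s IH] t p /=.
  by case: p => //=; rewrite /intervals_in /= !sub0set.
have IH' t' p' W : W \in alternating t' p' s ->
    [/\ W.1 \subset W.2, W.2 \subset [set:: s] & W.2 \subset [set:: x :: s]].
  move=> /(allP (IH t' p')) /andP[s1 s2]; split=> //.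
  by rewrite set_cons (subset_trans s2) ?subsetUr.
apply/allP=> W; case: t; rewrite ?mem_cat => /=.
  move=> /mapP[W' /IH' [s1 s2 _] ->] /=.
  by rewrite set_cons setUS // (subset_trans s1) ?subsetUr.
case/orP=> [/mapP[W' /IH' [s1 s2 _] ->]|/IH' [-> _ ->]] //=.
by rewrite set_cons !setUS.
Qed.

(** Whether X is covered is decided by scanning s with a two-state automaton, of
    which this is the transition rule. *)
Lemma multiplicity_alternating t p x s X : x \notin s ->
  multiplicity (alternating t p (x :: s)) X =
  if t then multiplicity (alternating false p s) (X :\ x)
  else if x \in X then multiplicity (alternating false (~~ p) s) (X :\ x)
  else multiplicity (alternating true p s) X.
Proof.
move=> xs; have out t' p' W : W \in alternating t' p' s ->
    x \notin W.1 /\ x \notin W.2.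
  move=> /(allP (alternating_in t' p' s)) /andP[/subsetP s1 /subsetP s2].
  by split; apply: contra xs; [move=> /s1 /s2|move=> /s2]; rewrite inE.
case: t => /=.
  rewrite /multiplicity count_map; apply: eq_in_count => W /out [x1 x2] /=.
  by rewrite /covers /= -subDset subsetD1 x1 andbT.
rewrite /multiplicity count_cat count_map; case: ifP => xX.
  rewrite [X in _ + X](_ : _ = 0) ?addn0.
    apply: eq_in_count => W /out [x1 x2] /=.
    by rewrite /covers /= -subDset subUset sub1set xX subsetD1 x1 andbT.
  apply/eqP; rewrite -leqn0 leqNgt -has_count; apply/hasPn=> W /out[_ x2].
  by apply: contra x2 => /andP[_ /subsetP]; exact.
rewrite [X in X + _](_ : _ = 0) //.
apply/eqP; rewrite -leqn0 leqNgt -has_count; apply/hasPn=> W _ /=.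
by rewrite /covers /= subUset sub1set xX.
Qed.

(** The scan is deterministic, so a set has a single bottom for a given start, and
    the size of this bottom has a single parity. *)
Lemma alternating_parity t s X : uniq s -> X \subset [set:: s] ->
  multiplicity (alternating t false s) X + multiplicity (alternating t true s) X
    = 1.
Proof.
elim: s t X => [|x s IH] t X.
  rewrite set_nil subset0 => _ /eqP ->.
  by rewrite /multiplicity /= /covers /= subxx.
rewrite cons_uniq => /andP[xs us]; rewrite set_cons -subDset => sX.
rewrite !multiplicity_alternating //.
case: t; first exact: IH; case: ifP => [_|xX] /=; first by rewrite addnC IH.
apply: IH => //; suff <- : X :\ x = X by [].
by apply/setDidPl; rewrite disjoint_sym disjoints1 xX.
Qed.

Lemma alternating_set0 t s : uniq s ->
  multiplicity (alternating t true s) set0 = 0.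
Proof.
elim: s t => [|x s IH] t //; rewrite cons_uniq => /andP[xs us].
by rewrite multiplicity_alternating // set0D inE !IH // if_same.
Qed.

(** The two starts treat the first element of X oppositely, one putting it in the
    bottom and the other not, and agree from there on.  The two bottoms thus
    differ in size by one, and exactly one of them is odd; for the empty set
    both are even. *)
Lemma alternating_start s X : uniq s -> X \subset [set:: s] -> X != set0 ->
  multiplicity (alternating true true s) X
    + multiplicity (alternating false true s) X = 1.
Proof.
elim: s X => [|x s IH] X; first by rewrite set_nil subset0 => _ ->.
rewrite cons_uniq => /andP[xs us]; rewrite set_cons -subDset => sX X0.
rewrite !multiplicity_alternating //.
case: ifP => [_|xX]; first by rewrite addnC alternating_parity.
have eX : X :\ x = X by apply/setDidPl; rewrite disjoint_sym disjoints1 xX.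
by rewrite eX in sX *; rewrite addnC IH.
Qed.

(** Of two consecutive elements that are not in the bottom, exactly one is in the
    top, so that a top has about half of the elements. *)
Lemma alternating_tops t p s : uniq s ->
  tops_ge (size s + t + p)./2 (alternating t p s).
Proof.
elim: s t p => [|x s IH] t p /=; first by case: p => //=; case: t.
move=> /andP[xs us].
have card1 t' p' W : W \in alternating t' p' s ->
    #|x |: W.2| = #|W.2|.+1.
  move=> /(allP (alternating_in t' p' s)) /andP[_ /subsetP s2].
  by rewrite cardsU1; case: (boolP (x \in W.2)) => // /s2; rewrite inE (negPf xs).
apply/allP=> W; case: t.
  move=> /mapP[W' W'L ->] /=; rewrite (card1 _ _ _ W'L).
  by have := allP (IH false p us) _ W'L; lia.
rewrite mem_cat => /orP[/mapP[W' W'L ->] /=|W'L].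
  rewrite (card1 _ _ _ W'L).
  by have := allP (IH false (~~ p) us) _ W'L; case: (p) => /=; lia.
by have := allP (IH true p us) _ W'L; lia.
Qed.

(** The theorem of Biro, Howard, Keller, Trotter and Young: requiring odd bottoms
    and allowing both starts covers each nonempty set once. *)
Theorem nonempty_subsets_partition J : exists L,
  interval_partition J (fun X => X != set0) L /\ tops_ge (uphalf #|J|) L.
Proof.
have uJ := enum_uniq J; have sJ : [set:: enum J] = J by exact: set_enum.
exists (alternating true true (enum J) ++ alternating false true (enum J)).
split; last first.
  rewrite cardE /tops_ge all_cat; apply/andP; split; apply/allP=> W IL.
    by apply: leq_trans (allP (alternating_tops _ _ uJ) _ IL); lia.
  by apply: leq_trans (allP (alternating_tops _ _ uJ) _ IL); lia.
have inJ : intervals_in J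
    (alternating true true (enum J) ++ alternating false true (enum J)).
  rewrite /intervals_in all_cat -{1 3}sJ.
  by apply/andP; split; apply: alternating_in.
split=> // X; have [sX|nsX] := boolP (X \subset J); last first.
  exact: multiplicity_out nsX.
rewrite /multiplicity count_cat -!/(multiplicity _ _) /=.
case: eqVneq => [->|X0]; first by rewrite !alternating_set0.
by rewrite alternating_start // sJ.
Qed.


(** * Sets that miss one of three blocks *)

Definition cell L X := nth (set0, set0) L (find (covers X) L).

Lemma cellP J D L X : interval_partition J D L -> X \subset J -> D X ->
  cell L X \in L /\ covers X (cell L X).
Proof.
move=> [_ mL] sX DX; have hX : has (covers X) L.
  by rewrite has_count -/(multiplicity L X) mL sX DX.
by rewrite mem_nth -?has_find // nth_find.
Qed.

Lemma mem_cell J D L X W : interval_partition J D L ->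
  W \in L -> covers X W -> (X \subset J) && D X.
Proof.
move=> [_ mL] WL XW; suff : 0 < multiplicity L X by rewrite mL lt0b.
by rewrite /multiplicity -has_count; apply/hasP; exists W.
Qed.

Lemma cell_uniq J D L X W : interval_partition J D L ->
  W \in L -> covers X W -> cell L X = W.
Proof.
move=> partL WL XW; have [inL mL] := partL.
have /andP[sX DX] := mem_cell partL WL XW.
have [cL Xc] := cellP partL sX DX.
have : multiplicity L X = 1 by rewrite mL sX DX.
rewrite /multiplicity -size_filter.
case eZ: (filter _ L) => [|Z []] // _.
have mem U : U \in L -> covers X U -> U = Z.
  by move=> UL XU; apply/eqP; rewrite -mem_seq1 -eZ mem_filter XU.
by rewrite (mem _ cL Xc) (mem _ WL XW).
Qed.

Definition misses_block A B C : pred {set V} :=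
  fun X => [|| [disjoint X & A], [disjoint X & B] | [disjoint X & C]].

(** The partition is: the subsets of A + B in one interval, then the products of
    all subsets of A and of the nonempty subsets of B with the nonempty subsets
    of C. *)
Lemma misses_block_partition A B C :
    [disjoint A & B] -> [disjoint A & C] -> [disjoint B & C] ->
    A :|: B :|: C = [set: V] -> #|A| <= uphalf #|B| ->
  exists L, interval_partition [set: V] (misses_block A B C) L
  /\ tops_ge (#|A| + minn #|B| (uphalf #|C|)) L.
Proof.
move=> disAB disAC disBC coverV hAB.
have [LB [partB topB]] := nonempty_subsets_partition B.
have [LC [partC topC]] := nonempty_subsets_partition C.
have partAC := interval_partition_prod disAC (interval_partition1 A) partC.
have partBC := interval_partition_prod disBC partB partC.
exists ((set0, A :|: B) :: interval_prod [:: (set0, A)] LC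
        ++ interval_prod LB LC); split; last first.
  rewrite /tops_ge -cat1s all_cat; apply/andP; split.
    by rewrite /= cardsU (disjoint_setI0 disAB) cards0 subn0 andbT; lia.
  rewrite all_cat; apply/andP; split.
  - have tA : tops_ge #|A| [:: (@set0 V, A)] by rewrite /tops_ge /= leqnn.
    have /allP t := tops_ge_prod disAC (interval_partition1 A).1 partC.1 tA topC.
    by apply/allP=> W /t /=; lia.
  have /allP t := tops_ge_prod disBC partB.1 partC.1 topB topC.
  by apply/allP=> W /t /=; lia.
split=> [|X].
  rewrite /intervals_in -cat1s all_cat; apply/andP; split.
    by rewrite /= sub0set subsetT.
  rewrite all_cat; apply/andP; split.
  - by apply/allP=> W /(allP partAC.1)/andP[-> _]; rewrite subsetT.
  by apply/allP=> W /(allP partBC.1)/andP[-> _]; rewrite subsetT.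
rewrite /multiplicity -cat1s 2!count_cat -!/(multiplicity _ _) partAC.2 partBC.2.
have sub (Y Z T : {set V}) : Y :|: Z :|: T = [set: V] -> [disjoint Y & T] ->
    [disjoint Z & T] -> (X \subset Y :|: Z) = (X :&: T == set0).
  move=> cov dYT dZT; rewrite setI_eq0 disjoints_subset.
  suff -> : Y :|: Z = ~: T by [].
  apply/setP=> x; rewrite !inE; have := in_setT x; rewrite -cov !inE.
  have := disjointFr dYT (x := x); have := disjointFr dZT (x := x).
  by case: (x \in Y) (x \in Z) (x \in T) => [] [] [] // a b; rewrite ?a ?b.
have sAB := sub A B C coverV disAC disBC.
have sAC : (X \subset A :|: C) = (X :&: B == set0).
  by apply: sub; rewrite // 1?setUAC // disjoint_sym.
have sBC : (X \subset B :|: C) = (X :&: A == set0).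
  by apply: sub; rewrite 1?disjoint_sym // setUC setUA.
rewrite /= addn0 /covers /= sub0set subsetT sAB sAC sBC /misses_block -!setI_eq0.
by case: (X :&: A == _) (X :&: B == _) (X :&: C == _) => [] [] [].
Qed.

Lemma misses_block_swap A B C : misses_block A B C =1 misses_block A C B.
Proof. by move=> X; rewrite /misses_block; congr (_ || _); rewrite orbC. Qed.

Lemma eq_interval_partition J D1 D2 L : D1 =1 D2 ->
  interval_partition J D1 L -> interval_partition J D2 L.
Proof. by move=> eD [inL mL]; split=> // X; rewrite mL eD. Qed.

(** On the elements of C, the relation that c' lies in the top of the cell of
    c |: A is reflexive and antisymmetric, hence has at most #|C| (#|C| + 1) / 2
    pairs, while every c is related to at least d - #|A| elements. *)
Lemma avoiding_top_le A B C L d :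
    [disjoint A & B] -> [disjoint A & C] -> [disjoint B & C] ->
    A :|: B :|: C = [set: V] -> A != set0 -> C != set0 ->
    interval_partition [set: V] (misses_block A B C) L -> tops_ge d L ->
    [disjoint (cell L A).2 & C] ->
  d <= #|A| + uphalf #|C|.
Proof.
move=> disAB disAC disBC cov A0 C0 partL topL disA.
pose G c := (cell L (c |: A)).2 :\: A.
have ok X : [disjoint X & B] -> cell L X \in L /\ covers X (cell L X).
  by move=> XB; apply: cellP partL _ _; rewrite ?subsetT // /misses_block XB orbT.
have okA := ok _ disAB.
have okC c : c \in C -> [disjoint c |: A & B].
  move=> cC; rewrite -setI_eq0 setIUl setU_eq0 !setI_eq0 disAB disjoints1.
  by rewrite (disjointFl disBC cC).
have cG c : c \in C -> c \in G c.
  move=> cC; have [_ /andP[_ /subsetP s]] := ok _ (okC _ cC).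
  by rewrite inE (disjointFl disAC cC) s // setU11.
have GC c : c \in C -> G c \subset C.
  move=> cC; have [cL /andP[s1 s2]] := ok _ (okC _ cC).
  have : covers (cell L (c |: A)).2 (cell L (c |: A)).
    by rewrite /covers subxx andbT (subset_trans s1).
  move=> /(mem_cell partL cL) /andP[_]; rewrite /misses_block.
  have meetA : ~~ [disjoint (cell L (c |: A)).2 & A].
    rewrite -setI_eq0; apply: contra A0 => /eqP e0.
    by rewrite -subset0 -e0 subsetI subxx andbT (subset_trans _ s2) ?subsetUr.
  have meetC : ~~ [disjoint (cell L (c |: A)).2 & C].
    apply/negP=> /disjointFl -/(_ _ cC); rewrite (subsetP s2) //; exact: setU11.
  rewrite (negPf meetA) (negPf meetC) /= orbF => disB.
  apply/subsetP=> x; rewrite inE => /andP[nA xG]; have := in_setT x.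
  by rewrite -cov !inE (negPf nA) (disjointFr disB xG).
have cardG c : c \in C -> d <= #|A| + #|G c|.
  move=> cC; have [cL /andP[_ s2]] := ok _ (okC _ cC).
  apply: leq_trans (allP topL _ cL) _.
  by rewrite -(cardsID A) leq_add ?subset_leq_card ?subsetIr.
have asym c c' : c \in C -> c' \in C -> c != c' ->
    (c' \in G c) + (c \in G c') <= 1.
  move=> cC c'C ncc'; case: (boolP (c' \in G c)) => [c'G|_]; last exact: leq_b1.
  case: (boolP (c \in G c')) => // cG'.
  have [cL /andP[s1 s2]] := ok _ (okC _ cC).
  have [c'L /andP[s1' s2']] := ok _ (okC _ c'C).
  have e : cell L (c' |: A) = cell L (c |: A).
    transitivity (cell L (c |: (c' |: A))).
      apply/esym/(cell_uniq partL) => //; apply/andP; split.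
        exact: subset_trans s1' (subsetUr _ _).
      by move: cG'; rewrite subUset sub1set s2' inE => /andP[_ ->].
    apply: (cell_uniq partL) => //; apply/andP; split.
      by rewrite setUCA; apply: subset_trans s1 (subsetUr _ _).
    by move: c'G; rewrite setUCA subUset sub1set s2 inE => /andP[_ ->].
  have eA : cell L A = cell L (c |: A).
    apply: (cell_uniq partL) => //; apply/andP; split; last first.
      exact: subset_trans (subsetUr _ _) s2.
    rewrite e in s1'.
    have : (cell L (c |: A)).1 \subset (c |: A) :&: (c' |: A) by rewrite subsetI s1.
    rewrite -setUIl (_ : [set c] :&: [set c'] = set0) ?set0U //.
    by apply/setP=> x; rewrite !inE; case: eqP => // ->; rewrite (negPf ncc').
  have := disjointFl disA cC; rewrite eA.
  by rewrite (subsetP s2) // setU11.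
have cardE c : c \in C -> #|G c| = \sum_(c' in C) (c' \in G c).
  move=> cC; rewrite -sum1_card big_mkcond /= [RHS]big_mkcond /=.
  apply: eq_bigr => c' _; case: ifP => [/(subsetP (GC c cC)) -> //|_].
  by rewrite if_same.
(* Add the counts of the relation and of its transpose, loops counting twice. *)
have count2 : (\sum_(c in C) #|G c|).*2 <= #|C| * #|C|.+1.
  rewrite -addnn (eq_bigr _ cardE) {2}exchange_big -big_split /=.
  have -> : #|C| * #|C|.+1 = \sum_(c in C) \sum_(c' in C) (1 + (c == c')).
    rewrite -sum_nat_const; apply: eq_bigr => c cC.
    rewrite big_split /= sum1_card (bigD1 c) //= eqxx big1 ?addn0 ?addn1 //.
    by move=> c' /andP[_]; rewrite eq_sym => /negPf ->.
  apply: leq_sum => c cC; rewrite -big_split; apply: leq_sum => c' c'C /=.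
  by case: eqVneq => [->|]; [rewrite cG | move=> ?; rewrite asym].
have : #|C| * d <= \sum_(c in C) (#|A| + #|G c|).
  by rewrite -sum_nat_const; apply: leq_sum => c; exact: cardG.
rewrite big_split /= sum_nat_const => le1.
move: C0; rewrite -card_gt0 => C0.
suff : #|C| * d.*2 <= #|C| * (#|A|.*2 + #|C|.+1) by rewrite leq_pmul2l //; lia.
by rewrite -doubleMr mulnDr -doubleMr; lia.
Qed.

Lemma misses_block_tops_le A B C L d :
    [disjoint A & B] -> [disjoint A & C] -> [disjoint B & C] ->
    A :|: B :|: C = [set: V] -> A != set0 -> B != set0 -> #|B| <= #|C| ->
    interval_partition [set: V] (misses_block A B C) L -> tops_ge d L ->
  d <= #|A| + minn #|B| (uphalf #|C|).
Proof.
move=> disAB disAC disBC cov A0 B0 leBC partL topL.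
have C0 : C != set0 by move: B0 leBC; rewrite -!card_gt0; exact: leq_trans.
have topP X : cell L X \in L -> covers X (cell L X) ->
    misses_block A B C (cell L X).2.
  move=> cL /andP[s1 s2]; have : covers (cell L X).2 (cell L X).
    by rewrite /covers subxx andbT (subset_trans s1).
  by move=> /(mem_cell partL cL)/andP[].
have meets X Y : Y != set0 -> Y \subset X -> ~~ [disjoint X & Y].
  move=> Y0 sYX; rewrite -setI_eq0; apply: contra Y0 => /eqP e0.
  by rewrite -subset0 -e0 subsetI subxx andbT.
rewrite addn_minr leq_min; apply/andP; split.
  have [cL cX] : cell L (A :|: B) \in L /\ covers (A :|: B) (cell L (A :|: B)).
    apply: cellP partL _ _; rewrite ?subsetT // /misses_block.
    rewrite (_ : [disjoint A :|: B & C]) ?orbT //.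
    by rewrite -setI_eq0 setIUl setU_eq0 !setI_eq0 disAC disBC.
  have := topP _ cL cX; have /andP[_ s2] := cX; rewrite /misses_block.
  have sA := subset_trans (subsetUl A B) s2.
  have sB := subset_trans (subsetUr A B) s2.
  rewrite (negPf (meets _ A A0 sA)) (negPf (meets _ B B0 sB)) /=.
  move=> disC; apply: leq_trans (allP topL _ cL) _.
  apply: leq_trans (leq_card_setU A B); apply: subset_leq_card.
  apply/subsetP=> x xG; have := in_setT x.
  by rewrite -cov inE (disjointFr disC xG) orbF.
have [cL cA] : cell L A \in L /\ covers A (cell L A).
  by apply: cellP partL _ _; rewrite ?subsetT // /misses_block disAB orbT.
have := topP _ cL cA; have /andP[_ s2] := cA; rewrite /misses_block.
rewrite (negPf (meets _ A A0 s2)) /= => /orP[dis|dis]; last first.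
  exact: avoiding_top_le partL topL dis.
(* The roles of B and C are exchanged; the bound for B suffices as #|B| <= #|C|. *)
have partL' := eq_interval_partition (misses_block_swap A B C) partL.
apply: leq_trans (_ : #|A| + uphalf #|B| <= _); last by lia.
by apply: avoiding_top_le partL' topL dis => //;
  rewrite 1?disjoint_sym // setUAC.
Qed.

End Intervals.

(** * Monomials and their supports *)

Section Monomials.
Variables (K : fieldType) (n : nat).
Local Open Scope ring_scope.
Implicit Types (m : 'X_{1..n}) (p : {mpoly K[n]}) (X Z : {set 'I_n}).

Definition supp m : {set 'I_n} := [set i | m i != 0%N].

Definition sqf X : 'X_{1..n} := [multinom (i \in X : nat) | i < n].

Lemma supp_sqf X : supp (sqf X) = X.
Proof. by apply/setP=> i; rewrite inE mnmE; case: (i \in X). Qed.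

Lemma suppD m k : supp (m + k)%MM = supp m :|: supp k.
Proof. by apply/setP=> i; rewrite !inE mnmDE addn_eq0 negb_and. Qed.

Lemma monomial_onE Z m : monomial_on Z m = (supp m \subset Z).
Proof.
apply/forallP/subsetP=> [h i|h i]; first by rewrite inE; exact: implyP.
by apply/implyP=> mi; apply: h; rewrite inE.
Qed.

Lemma sqf_lem X m : (sqf X <= m)%MM = (X \subset supp m).
Proof.
apply/mnm_lepP/subsetP=> [h i iX|h i].
  by have := h i; rewrite mnmE iX inE lt0n.
by rewrite mnmE; case: (boolP (i \in X)) => // /h; rewrite inE lt0n.
Qed.

Lemma poly_onP Z p :
  reflect (forall m, p@_m != 0 -> supp m \subset Z) (poly_on Z p).
Proof.
apply: (iffP allP) => h m; last by rewrite mcoeff_msupp monomial_onE => /h.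
by rewrite -mcoeff_msupp -monomial_onE => /h.
Qed.

Lemma poly_on0 Z : poly_on Z (0 : {mpoly K[n]}).
Proof. by apply/poly_onP=> m; rewrite mcoeff0 eqxx. Qed.

Lemma poly_onZX Z (a : K) m : supp m \subset Z -> poly_on Z (a *: 'X_[m]).
Proof.
move=> mZ; apply/poly_onP=> k; rewrite mcoeffZ mcoeffX.
by case: (m =P k) => [<- //|_]; rewrite mulr0 eqxx.
Qed.

Lemma poly_on1 Z : poly_on Z (1 : {mpoly K[n]}).
Proof.
rewrite -mpolyX0 -[X in poly_on _ X]scale1r; apply: poly_onZX.
by apply/subsetP=> i; rewrite inE mnm0E.
Qed.

Lemma mcoeff_mulX p m k :
  (p * 'X_[m])@_k = if (m <= k)%MM then p@_(k - m)%MM else 0.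
Proof.
case: ifP => [le_mk|nle_mk].
  by rewrite -{1}(submK le_mk) addmC mcoeffMX.
apply: memN_msupp_eq0; rewrite (perm_mem (msuppMX _ _)).
by apply/mapP=> -[l _ ek]; move: nle_mk; rewrite ek lem_addr.
Qed.

End Monomials.

(** * Stanley spaces and Stanley depth *)

Section StanleySpaces.
Variables (K : fieldType) (n : nat) (M : gradedModule K n).
Local Open Scope ring_scope.
Implicit Types (u x : M) (Z : {set 'I_n}).

Lemma in_uKZP u Z x : in_uKZ u Z x <-> exists2 p, poly_on Z p & x = p *: u.
Proof.
split=> [[s [c [/allP sZ ->]]]|[p pZ ->]].
  exists (\sum_(m <- s) c m *: 'X_[m]).
    apply/allP=> m /msupp_sum_le /flattenP[l /mapP[k]].
    rewrite mem_filter => /andP[_ /sZ kZ] -> /msuppZ_le.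
    by rewrite msuppX inE => /eqP ->.
  by rewrite scaler_suml; apply: eq_bigr => m _; rewrite scalerA mul_mpolyC.
exists (msupp p), (fun m => p@_m); split=> //.
rewrite {1}[p]mpolyE scaler_suml.
by apply: eq_bigr => m _; rewrite scalerA mul_mpolyC.
Qed.

(** A monomial in K[Z] that kills u kills all of u K[Z], in particular a basis
    element, which has then two expressions in the basis. *)
Lemma stanley_space_torsionfree u Z (m : 'X_{1..n}) :
  stanley_space u Z -> u != 0 -> supp m \subset Z -> 'X_[m] *: u != 0.
Proof.
move=> [k [b [bN free]]] u0 mZ; apply/eqP=> mu0.
have uN : in_uKZ u Z u.
  by apply/in_uKZP; exists 1; rewrite ?scale1r ?poly_on1.
have [c [[_ uE] _]] := free _ uN.
case: k b bN free c uE => [|k] b bN free c uE.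
  by move: u0; rewrite uE big_ord0 eqxx.
have ann : 'X_[m] *: b ord0 = 0.
  have /in_uKZP[p _ ->] := bN ord0.
  by rewrite scalerA mulrC -scalerA mu0 scaler0.
have zeroN : in_uKZ u Z 0.
  by apply/in_uKZP; exists 0; rewrite ?scale0r ?poly_on0.
have [c0 [_ c0_uniq]] := free _ zeroN.
have e1 : c0 = [ffun=> 0].
  apply: c0_uniq; split=> [j|].
    by rewrite ffunE poly_on0.
  by rewrite big1 // => j _; rewrite ffunE scale0r.
have e2 : c0 = [ffun j => if j == ord0 then 'X_[m] else 0].
  apply: c0_uniq; split=> [j|].
    rewrite ffunE; case: ifP => _; last exact: poly_on0.
    by rewrite -['X_[m]]scale1r poly_onZX.
  rewrite (bigD1 ord0) //= ffunE eqxx ann add0r big1 // => j.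
  by rewrite ffunE => /negPf ->; rewrite scale0r.
have : c0 ord0 = c0 ord0 by [].
rewrite {1}e1 e2 !ffunE eqxx => /(congr1 (mcoeff m)).
by rewrite mcoeff0 mcoeffX eqxx => /eqP; rewrite eq_sym oner_eq0.
Qed.

Lemma leq_sdepth_dec d (D : stanleyDecomposition M) :
  (d <= sdepth_dec D)%N =
  ((d <= n)%N && [forall i, (d <= #|sd_vars (s := D) i|)%N]).
Proof.
rewrite /sdepth_dec; apply/idP/andP=> [le_d|[dn /forallP le_d]].
  split.
    apply: leq_trans le_d _; elim/big_rec: _ => // i x _ xn.
    exact: leq_trans (geq_minr _ _) xn.
  apply/forallP=> i; apply: leq_trans le_d _.
  elim: (index_enum _) (mem_index_enum i) => //= j s IH.
  rewrite inE big_cons geq_min => /predU1P[-> |/IH ->]; last exact: orbT.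
  by rewrite leqnn.
by elim/big_rec: _ => // i x _ dx; rewrite leq_min le_d.
Qed.

Lemma leq_sdepth d (D : stanleyDecomposition M) :
  (d <= sdepth_dec D)%N -> (d <= sdepth M)%N.
Proof.
move=> dD; have [nD _] := andP (etrans (esym (leq_sdepth_dec _ D)) (leqnn _)).
rewrite -ltnS in nD; apply: leq_trans dD _; rewrite /sdepth.
apply: (@leq_bigmax_cond _ _ (fun i : 'I_n.+1 => i : nat) (Ordinal nD)).
by apply/boolp.asboolP; exists D.
Qed.

Lemma sdepth_leq b : (forall D : stanleyDecomposition M, (sdepth_dec D <= b)%N) ->
  (sdepth M <= b)%N.
Proof.
by move=> h; apply/bigmax_leqP=> d /boolp.asboolP[D <-]; exact: h.
Qed.

End StanleySpaces.

(** * Stanley decompositions of S/I and interval partitions *)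

Section SquarefreeQuotient.
Variables (K : fieldType) (n : nat) (I : gradedIdeal K n).
Variable D : pred {set 'I_n}.
Local Open Scope ring_scope.
Hypothesis memI : forall m : 'X_{1..n}, ('X_[m] \in I) = ~~ D (supp m).
Local Notation M := (quot_module I).
Implicit Types (m : 'X_{1..n}) (p : {mpoly K[n]}) (X Z : {set 'I_n}).

Lemma mem_gradedIdeal p : reflect (forall m, p@_m != 0 -> ~~ D (supp m)) (p \in I).
Proof.
apply: (iffP idP) => [pI m pm|h].
  rewrite -memI -[X in X \in _]scale1r -(mulVf pm) -scalerA -mul_mpolyC.
  by apply: gi_M; exact: gi_graded.
rewrite [p]mpolyE big_seq; apply: (big_ind (fun q => q \in I)).
- exact: gi_0.
- exact: gi_D.
move=> m; rewrite mcoeff_msupp => pm; rewrite -mul_mpolyC.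
by apply: gi_M; rewrite memI h.
Qed.

Lemma qpi_eq p q : (forall m, p@_m != q@_m -> ~~ D (supp m)) -> qpi I p = qpi I q.
Proof.
move=> h; apply/qpiP/mem_gradedIdeal=> m; rewrite mcoeffB subr_eq0; exact: h.
Qed.

Lemma mcoeff_qpi p q m : qpi I p = qpi I q -> D (supp m) -> p@_m = q@_m.
Proof.
move=> /qpiP/mem_gradedIdeal h Dm; apply/eqP; rewrite -subr_eq0 -mcoeffB.
by apply: contraLR Dm => /h.
Qed.

(** Each graded component of S/I has dimension at most one.  The scalar may be 0,
    since the zero element is homogeneous. *)
Lemma homogeneous_qpi (u : M) : homogeneous u ->
  exists mc : 'X_{1..n} * K, u = qpi I (mc.2 *: 'X_[mc.1]).
Proof.
move=> [a [p [hp ->]]]; case: (msupp p =P [::]) => [/msuppnil0 ->|].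
  by exists (0%MM, 0); rewrite scale0r.
case E: (msupp p) => [|m s] // _; exists (m, p@_m); congr (qpi I _).
have mp : m \in msupp p by rewrite E mem_head.
apply/mpolyP=> k; rewrite mcoeffZ mcoeffX; case: eqP => [<-|ne].
  by rewrite mulr1.
rewrite mulr0; apply: memN_msupp_eq0; apply/negP=> kp; apply: ne.
apply/mnmP=> i; have /ffunP/(_ i) := etrans (hp _ mp) (esym (hp _ kp)).
by rewrite !ffunE => -[].
Qed.

Section FromPartition.
Variable L : seq ({set 'I_n} * {set 'I_n}).
Hypothesis partL : interval_partition [set: 'I_n] D L.

Local Notation W t := (tnth (in_tuple L) t).
Definition part_gen (t : 'I_(size L)) : M := qpi I 'X_[sqf (W t).1].
Definition part_vars (t : 'I_(size L)) : {set 'I_n} := (W t).2.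

Lemma mem_part (t : 'I_(size L)) : W t \in L.
Proof. exact: (mem_tnth t (in_tuple L)). Qed.

Lemma part_subset (t : 'I_(size L)) : (W t).1 \subset (W t).2.
Proof. by have /andP[] := allP partL.1 _ (mem_part t). Qed.

Lemma covers_suppD t m : supp m \subset part_vars t ->
  covers (supp (sqf (W t).1 + m)%MM) (W t).
Proof.
by move=> mZ; rewrite /covers suppD supp_sqf subsetUl subUset part_subset.
Qed.

Lemma covers_part X t : covers X (W t) -> D X.
Proof. by move=> /(mem_cell partL (mem_part _)); rewrite subsetT. Qed.

Lemma multiplicity_parts X : multiplicity L X = (\sum_t covers X (W t))%N.
Proof.
by rewrite /multiplicity -sum1_count big_mkcond /= (big_tnth _ _ L).
Qed.

Lemma covers_part_uniq X s t : covers X (W s) -> covers X (W t) -> s = t.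
Proof.
move=> Xs Xt; apply: contraTeq Xt => nst; move: (multiplicity_parts X).
rewrite partL.2 subsetT (covers_part Xs) (bigD1 s) //= Xs => -[/esym/eqP].
by rewrite sum_nat_eq0 => /forallP/(_ t); rewrite eq_sym nst eqb0.
Qed.

(** The Stanley space of an interval is spanned by the monomials with support in
    the interval. *)
Lemma in_part_space t (y : M) : in_uKZ (part_gen t) (part_vars t) y <->
  exists2 p, (forall m, p@_m != 0 -> covers (supp m) (W t)) & y = qpi I p.
Proof.
split=> [/in_uKZP[p /poly_onP pZ ->]|[p pW ->]].
  exists (p * 'X_[sqf (W t).1]); last by rewrite /part_gen qpiZ.
  move=> m; rewrite mcoeff_mulX; case: ifP => [le_m /pZ mZ|]; last by rewrite eqxx.
  by rewrite -(submK le_m) addmC covers_suppD.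
apply/in_uKZP.
exists (\sum_(m <- msupp p) p@_m *: 'X_[(m - sqf (W t).1)%MM]).
  apply/allP=> m /msupp_sum_le /flattenP[l /mapP[k]].
  rewrite mem_filter mcoeff_msupp => /pW /andP[_ kW] -> /msuppZ_le.
  rewrite msuppX inE => /eqP ->; rewrite monomial_onE.
  apply: subset_trans kW; apply/subsetP=> i; rewrite !inE mnmBE.
  by apply: contra => /eqP ->.
rewrite /part_gen -qpiZ; congr (qpi I _); rewrite {1}[p]mpolyE mulr_suml.
apply: eq_big_seq => m; rewrite mcoeff_msupp => /pW /andP[le_m _].
by rewrite -scalerAl -mpolyXD submK // sqf_lem.
Qed.

Lemma part_homogeneous t : homogeneous (part_gen t).
Proof.
exists (zdeg (sqf (W t).1)), 'X_[sqf (W t).1]; split=> // m.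
by rewrite msuppX inE => /eqP ->.
Qed.

Lemma part_stanley t : stanley_space (part_gen t) (part_vars t).
Proof.
exists 1%N, (fun=> part_gen t); split=> [_|x /in_uKZP[p /poly_onP pZ ->]].
  by apply/in_uKZP; exists 1; rewrite ?scale1r ?poly_on1.
exists [ffun=> p]; split; first split=> [j|].
- by rewrite ffunE; apply/poly_onP.
- by rewrite big_ord1 ffunE.
move=> c [/(_ ord0)/poly_onP cZ]; rewrite big_ord1 /part_gen -!qpiZ => e.
apply/ffunP=> j; rewrite ord1 ffunE; apply/mpolyP=> m.
have [mZ|nmZ] := boolP (supp m \subset part_vars t).
  have := mcoeff_qpi e (covers_part (covers_suppD mZ)).
  by rewrite !mcoeffMX.
have -> : p@_m = 0 by apply/eqP; apply: contraNT nmZ; exact: pZ.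
by apply/esym/eqP; apply: contraNT nmZ; exact: cZ.
Qed.

Definition part_poly p t : {mpoly K[n]} :=
  \sum_(m <- msupp p | covers (supp m) (W t)) p@_m *: 'X_[m].

Lemma mcoeff_part_poly p t m :
  (part_poly p t)@_m = if covers (supp m) (W t) then p@_m else 0.
Proof.
rewrite /part_poly raddf_sum /=; case: ifP => [mW|nmW]; last first.
  rewrite big1 // => k kW; rewrite mcoeffZ mcoeffX; case: eqP => [ek|].
    by rewrite -ek kW in nmW.
  by rewrite mulr0.
have [mp|nmp] := boolP (m \in msupp p); last first.
  rewrite (memN_msupp_eq0 nmp) big_seq_cond big1 // => k /andP[kp _].
  rewrite mcoeffZ mcoeffX; case: eqP => [ek|]; last by rewrite mulr0.
  by rewrite -ek kp in nmp.
rewrite big_mkcond (bigD1_seq m) ?msupp_uniq //= mW mcoeffZ mcoeffX eqxx mulr1.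
rewrite big1 ?addr0 // => k nkm.
by rewrite mcoeffZ mcoeffX (negPf nkm) mulr0 if_same.
Qed.

Lemma part_direct (x : M) : exists! y : {ffun 'I_(size L) -> M},
  (forall t, in_uKZ (part_gen t) (part_vars t) (y t)) /\ x = \sum_t y t.
Proof.
have [p ->] := qpi_surj x.
have sum_qpi (f : 'I_(size L) -> {mpoly K[n]}) :
    \sum_t (qpi I (f t) : M) = qpi I (\sum_t f t) by rewrite -qpi_sum.
exists [ffun t => qpi I (part_poly p t)]; split; first split=> [t|].
- rewrite ffunE; apply/in_part_space; exists (part_poly p t) => // m.
  by rewrite mcoeff_part_poly; case: ifP => //; rewrite eqxx.
- under eq_bigr do rewrite ffunE; rewrite sum_qpi; apply: qpi_eq => m.
  apply: contraNN => Dm.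
  have : has (covers (supp m)) L.
    by rewrite has_count -/(multiplicity _ _) partL.2 subsetT Dm.
  move=> /hasP[U /(nthP U)[t tL <-]]; 
  rewrite -(tnth_nth U (in_tuple L) (Ordinal tL)) => mt.
  rewrite raddf_sum (bigD1 (Ordinal tL)) //= mcoeff_part_poly mt.
  rewrite big1 ?addr0 // => s.
  rewrite mcoeff_part_poly; case: ifP => // ms /eqP[]; exact: covers_part_uniq mt.
move=> y [yP yE].
have /boolp.choice[q qP] : forall t, exists q,
    (forall m, q@_m != 0 -> covers (supp m) (W t)) /\ y t = qpi I q.
  by move=> t; have /in_part_space[q ? ?] := yP t; exists q.
have e : qpi I p = qpi I (\sum_t q t).
  by rewrite -sum_qpi yE; apply: eq_bigr => t _; exact: (qP t).2.
apply/ffunP=> t; rewrite ffunE (qP t).2; apply: qpi_eq => m.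
apply: contraNN => Dm; rewrite mcoeff_part_poly; case: ifP => mt; last first.
  by rewrite eq_sym; apply: contraFT mt; exact: (qP t).1.
rewrite (mcoeff_qpi e Dm) raddf_sum (bigD1 t) //= big1 ?addr0 // => s nst.
apply/eqP; apply: contraNT nst => /(qP s).1 ms; apply/eqP.
exact: covers_part_uniq mt.
Qed.

Definition part_decomposition : stanleyDecomposition M :=
  StanleyDecomposition part_homogeneous part_stanley part_direct.

Lemma partition_leq_sdepth d : (d <= n)%N -> tops_ge d L -> (d <= sdepth M)%N.
Proof.
move=> dn /allP topL; apply: (leq_sdepth (D := part_decomposition)).
rewrite leq_sdepth_dec dn; apply/forallP=> t; exact: topL (mem_part _).
Qed.

End FromPartition.

(** The intervals come from the nonzero summands with squarefree generator.  A
    nonzero squarefree monomial lies in one of the u_i K[Z_i] because the sum is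
    all of S/I, and in no other because the sum is direct. *)
Lemma decomposition_partition (SD : stanleyDecomposition M) : exists L,
  interval_partition [set: 'I_n] D L /\ tops_ge (sdepth_dec SD) L.
Proof.
have /boolp.choice[mc genE] : forall i, exists mc : 'X_{1..n} * K,
    sd_gen (s := SD) i = qpi I (mc.2 *: 'X_[mc.1]).
  by move=> i; exact: homogeneous_qpi (sd_homogeneous i).
pose gen i := sd_gen (s := SD) i; pose vars i := sd_vars (s := SD) i.
pose e i := (mc i).1; pose c i := (mc i).2.
have genX i : gen i = qpi I (c i *: 'X_[e i]) := genE i.
pose W i := (supp (e i), supp (e i) :|: vars i).
pose usable i := (gen i != 0) && (sqf (supp (e i)) == e i).
pose L := [seq W i | i <- enum 'I_(sd_size SD) & usable i].
have multL X : multiplicity L X = (\sum_(i | usable i) covers X (W i))%N.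
  rewrite /multiplicity count_map count_filter -sum1_count.
  rewrite big_enum_cond /= [LHS]big_mkcond [RHS]big_mkcond /=.
  by apply: eq_bigr => i _; rewrite andbC; case: (usable i) => //=; case: covers.
have spaceX i X : usable i -> covers X (W i) ->
    in_uKZ (gen i) (vars i) (qpi I 'X_[sqf X] : M) /\ qpi I 'X_[sqf X] <> 0.
  move=> /andP[gen0 /eqP sqe] /andP[/= eX Xe].
  have le_e : (e i <= sqf X)%MM by rewrite -sqe sqf_lem supp_sqf.
  pose k := (sqf X - e i)%MM; have kE : sqf X = (k + e i)%MM by rewrite submK.
  have kZ : supp k \subset vars i.
    apply/subsetP=> j; rewrite inE mnmBE mnmE.
    case: (boolP (j \in X)) => [jX|_]; last by rewrite sub0n.
    have := subsetP Xe _ jX; rewrite !inE; case/orP=> //.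
    by rewrite -lt0n -subn_eq0; case: (e i j).
  have c0 : c i != 0.
    apply: contraNneq gen0 => c0; rewrite genX c0 scale0r.
    by apply/eqP/qpi0P; exact: gi_0.
  have genk : 'X_[k] *: gen i = (qpi I (c i *: 'X_[sqf X]) : M).
    by rewrite genX -qpiZ -scalerAr -mpolyXD -kE.
  have XE : (qpi I 'X_[sqf X] : M) = ((c i)^-1 *: 'X_[k]) *: gen i.
    by rewrite genX -qpiZ -scalerAl -scalerAr scalerA mulVf // scale1r -mpolyXD -kE.
  split.
    by apply/in_uKZP; exists ((c i)^-1 *: 'X_[k]); rewrite ?poly_onZX.
  move=> X0; have := stanley_space_torsionfree (sd_stanley i) gen0 kZ.
  by rewrite genk -mul_mpolyC qpiZ X0 scaler0 eqxx.
have validX i X : usable i -> covers X (W i) -> D X.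
  move=> ui /(spaceX _ _ ui)[_]; apply: contra_notT => nDX.
  by apply/qpi0P; rewrite memI supp_sqf.
have uniqX i j X : usable i -> usable j -> covers X (W i) -> covers X (W j) ->
    i = j.
  move=> ui uj /(spaceX _ _ ui)[Xi X0] /(spaceX _ _ uj)[Xj _].
  have [y [_ y_uniq]] := sd_direct SD (qpi I 'X_[sqf X] : M).
  have single k : in_uKZ (gen k) (vars k) (qpi I 'X_[sqf X] : M) ->
      y = [ffun l => if l == k then qpi I 'X_[sqf X] : M else 0].
    move=> Xk; apply: y_uniq; split=> [l|].
      rewrite ffunE; case: eqP => [->|_] //.
      by apply/in_uKZP; exists 0; rewrite ?scale0r ?poly_on0.
    rewrite (bigD1 k) //= ffunE eqxx big1 ?addr0 // => l nlk.
    by rewrite ffunE (negPf nlk).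
  apply/eqP; apply: contra_notT X0 => nij.
  have : y i = y i by [].
  by rewrite {1}(single i Xi) (single j Xj) !ffunE eqxx (negPf nij).
have existsX X : D X -> exists2 i, usable i & covers X (W i).
  move=> DX; have [y [[yP yE] _]] := sd_direct SD (qpi I 'X_[sqf X] : M).
  have /boolp.choice[p pP] : forall i, exists p,
      poly_on (vars i) p /\ y i = p *: gen i.
    by move=> i; have /in_uKZP[p ? ?] := yP i; exists p.
  have E : qpi I 'X_[sqf X] = qpi I (\sum_i c i *: (p i * 'X_[e i])).
    rewrite qpi_sum; transitivity (\sum_i y i) => //; apply: eq_bigr => i _.
    by rewrite (pP i).2 genX -qpiZ -scalerAr.
  have DX' : D (supp (sqf X)) by rewrite supp_sqf.
  have := mcoeff_qpi E DX'; rewrite mcoeffX eqxx raddf_sum /= => sum1.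
  (* Some summand involves the monomial sqf X itself. *)
  have [i ni] : exists i, (c i *: (p i * 'X_[e i]))@_(sqf X) != 0.
    apply/existsP; rewrite -negb_forall; apply/negP=> /forallP all0.
    move: sum1; rewrite big1; first by move/eqP; rewrite oner_eq0.
    by move=> i _; apply/eqP; exact: all0.
  move: ni; rewrite mcoeffZ mulf_eq0 negb_or mcoeff_mulX => /andP[ci].
  case: ifP => [le_e pi|]; last by rewrite eqxx.
  have /poly_onP/(_ _ pi) kZ := (pP i).1.
  have sqe : sqf (supp (e i)) = e i.
    apply/mnmP=> j; rewrite mnmE inE; have /mnm_lepP/(_ j) := le_e.
    by rewrite mnmE; case: (e i j) => [|[|]] //; case: (j \in X).
  have eX : supp (e i) \subset X by move: le_e; rewrite -{1}sqe sqf_lem supp_sqf.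
  exists i.
    rewrite /usable sqe eqxx andbT; apply/eqP=> gen0.
    have /mcoeff_qpi : qpi I (p i * (c i *: 'X_[e i])) = qpi I 0.
      transitivity (p i *: gen i : M); first by rewrite genX -qpiZ.
      by rewrite gen0 scaler0; apply/esym/qpi0P/gi_0.
    move=> /(_ _ DX'); rewrite mcoeff0 -scalerAr mcoeffZ mcoeff_mulX le_e.
    by move/eqP; rewrite mulf_eq0 (negPf ci) (negPf pi).
  rewrite /covers eX; apply/subsetP=> j jX; rewrite in_setU.
  have [//|nje] := boolP (j \in supp (e i)).
  apply: (subsetP kZ); move: nje; rewrite !inE negbK mnmBE mnmE jX => /eqP ->.
  by [].
exists L; split; first split.
- by apply/allP=> U /mapP[i _ ->]; rewrite subsetUl subsetT.
- move=> X; rewrite subsetT multL /=.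
  case: (boolP (D X)) => [/existsX[i ui Xi]|nDX].
    rewrite (bigD1 i) //= Xi big1 // => j /andP[uj nji]; apply/eqP.
    by rewrite eqb0; apply: contra nji => Xj; apply/eqP/(uniqX _ _ X).
  rewrite big1 // => i ui; apply/eqP; rewrite eqb0.
  by apply: contra nDX; exact: validX.
apply/allP=> U /mapP[i _ ->] /=; apply: leq_trans (subset_leq_card (subsetUr _ _)).
by have := leqnn (sdepth_dec SD); rewrite leq_sdepth_dec => /andP[_ /forallP].
Qed.

End SquarefreeQuotient.

Lemma var_ideal_monomial (K : fieldType) n (J : {set 'I_n}) (m : 'X_{1..n}) :
  ('X_[m] \in var_ideal K J)%R = ~~ [disjoint supp m & J].
Proof.
rewrite -setI_eq0; apply/var_ideal_memP/set0Pn => [[c mE]|[i]]; last first.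
  rewrite !inE => /andP[mi iJ].
  exists (fun j => if j == i then 'X_[m - U_(i)] else 0)%R.
  rewrite (bigD1 i) //= eqxx big1 => [|j /andP[_ /negPf ->]]; last by rewrite mul0r.
  by rewrite addr0 -mpolyXD submK // lep1mP.
have [i iJ ci] : exists2 i, i \in J & ((c i * 'X_i)@_m != 0)%R.
  apply/exists_inP; rewrite -negb_forall_in; apply/negP=> /forall_inP all0.
  have /(congr1 (mcoeff m)) := mE; rewrite mcoeffX eqxx raddf_sum /= big1.
    by move/eqP; rewrite oner_eq0.
  by move=> i /all0 /eqP.
exists i; rewrite !inE iJ andbT; move: ci; rewrite mcoeff_mulX lep1mP.
by case: ifP => //; rewrite eqxx.
Qed.

(** * The three blocks of variables *)

Lemma card_block n a b : b <= n -> #|[set i : 'I_n | a <= i < b]| = b - a.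
Proof.
move=> le_bn; rewrite -sum1dep_card.
rewrite -(big_mkord (fun i => a <= i < b) (fun=> 1)) sum1_count.
rewrite -size_filter -[RHS](size_iota a).
apply/perm_size/uniq_perm; rewrite ?filter_uniq ?iota_uniq // => i.
by rewrite mem_filter mem_index_iota mem_iota; lia.
Qed.

Lemma disjoint_blocks n a b c d : b <= c ->
  [disjoint [set i : 'I_n | a <= i < b] & [set i : 'I_n | c <= i < d]].
Proof.
move=> le_bc; rewrite -setI_eq0; apply/eqP/setP=> i; rewrite !inE.
by apply/negP; lia.
Qed.

Theorem corollary2p7 (K : fieldType) (n r e q : nat)
    (h1r : 1 <= r) (hre : r <= e) (heq : e <= q) (hn : r + e + q = n)
    (hr : r <= uphalf e) :
  let P1 := block_ideal K n 0 r in
  let P2 := block_ideal K n r (r + e) in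
  let P3 := block_ideal K n (r + e) (r + e + q) in
  let I := cap_ideal (cap_ideal P1 P2) P3 in
  sdepth (quot_module I) = r + minn e (uphalf q).
Proof.
move=> P1 P2 P3 I.
pose A := [set i : 'I_n | 0 <= i < r].
pose B := [set i : 'I_n | r <= i < r + e].
pose C := [set i : 'I_n | r + e <= i < r + e + q].
have cA : #|A| = r by rewrite card_block ?subn0 //; lia.
have cB : #|B| = e by rewrite card_block; lia.
have cC : #|C| = q by rewrite card_block; lia.
have disAB : [disjoint A & B] by apply: disjoint_blocks.
have disAC : [disjoint A & C] by apply: disjoint_blocks; lia.
have disBC : [disjoint B & C] by apply: disjoint_blocks.
have cov : A :|: B :|: C = [set: 'I_n].
  by apply/setP=> i; rewrite !inE; have := ltn_ord i; lia.
have memI (m : 'X_{1..n}) : ('X_[m] \in I)%R = ~~ misses_block A B C (supp m).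
  rewrite /misses_block !negb_or andbA.
  rewrite -(var_ideal_monomial K A) -(var_ideal_monomial K B).
  by rewrite -(var_ideal_monomial K C).
rewrite -[in RHS]cA -[in RHS]cB -[in RHS]cC.
apply/eqP; rewrite eqn_leq; apply/andP; split.
  apply: sdepth_leq => SD.
  have [L [partL topL]] := decomposition_partition memI SD.
  by apply: misses_block_tops_le partL topL => //;
    rewrite -?card_gt0 ?cA ?cB ?cC //; lia.
have leAB : #|A| <= uphalf #|B| by rewrite cA cB.
have [L [partL topL]] := misses_block_partition disAB disAC disBC cov leAB.
apply: (partition_leq_sdepth memI partL _ topL).
by rewrite cA cB cC; lia.
Qed.
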